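(* For all closed pACP terms $t$ and $t'$, $t \leftrightarrow t'$ only if $t = t'$ is derivable from the axioms of pACP.
   Context: Setting. A set $A$ of actions with $\delta\notin A$ and a commutative, associative communication function $\gamma$ on $A\cup\{\delta\}$ ($\gamma(\delta,a)=\delta$) are given; probabilities are the elements $0\le\pi\le1$ of a fixed signed cancellation meadow (commutative ring with unit, total inverse with $0^{-1}=0$, signum). Closed pACP terms (no recursion) are built from $a\in A$, $\delta$, $+$, $\cdot$, probabilistic choice $x\oplus_\pi y$, $\parallel$, left merge $\mathbin{\lfloor\!\lfloor}$, communication merge $\mid$, and encapsulation $\partial_H$ ($H\subseteq A$). Axioms of pACP ($a,b$ range over $A\cup\{\delta\}$): $x+y=y+x$; $(x+y)+z=x+(y+z)$; $a+a=a$; $(x+y)\cdot z=x\cdot z+y\cdot z$; $(x\cdot y)\cdot z=x\cdot(y\cdot z)$; $x+\delta=x$; $\delta\cdot x=\delta$; $\partial_H(a)=a$ if $a\notin H$, $\partial_H(a)=\delta$ if $a\in H$; $\partial_H$ distributes over $+$, $\cdot$ and $\oplus_\pi$; $x\oplus_\pi y=y\oplus_{1-\pi}x$; $(x\oplus_\pi y)\oplus_\rho z=x\oplus_{\pi\rho}(y\oplus_{(1-\pi)\rho/(1-\pi\rho)}z)$; $x\oplus_\pi x=x$; $(x\oplus_\pi y)\cdot z=x\cdot z\oplus_\pi y\cdot z$; $(x\oplus_\pi y)+z=(x+z)\oplus_\pi(y+z)$; $x\oplus_1 y=x$; $x=x+x\wedge y=y+y\Rightarrow x\parallel y=x\mathbin{\lfloor\!\lfloor}y+y\mathbin{\lfloor\!\lfloor}x+x\mid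 y$; $a\mathbin{\lfloor\!\lfloor}x=a\cdot x$; $a\cdot x\mathbin{\lfloor\!\lfloor}y=a\cdot(x\parallel y)$; $(x+y)\mathbin{\lfloor\!\lfloor}z=x\mathbin{\lfloor\!\lfloor}z+y\mathbin{\lfloor\!\lfloor}z$; $a\cdot x\mid b=\gamma(a,b)\cdot x$; $a\mid b\cdot x=\gamma(a,b)\cdot x$; $a\cdot x\mid b\cdot y=\gamma(a,b)\cdot(x\parallel y)$; $\mid$ distributes over $+$ in both arguments; $\delta\mid x=\delta$; $x\mid\delta=\delta$; $a\mid b=\gamma(a,b)$; $\parallel$, $\mathbin{\lfloor\!\lfloor}$ and $\mid$ distribute over $\oplus_\pi$ in both arguments. Semantics: relations ''$t\downarrow a$'' ($t$ can perform $a$ and then terminate successfully), $t\xrightarrow{a}t'$, and $t\overset{\pi}{\rightsquigarrow}t'$ ($t$ behaves as $t'$ with probability $\pi$), given by structural operational rules in which probabilistic choices are resolved before choices in $+$ and $\parallel$ (e.g. $x\oplus_\pi y\overset{\pi\rho+(1-\pi)\rho'}{\rightsquigarrow}z$ if $x\overset{\rho}{\rightsquigarrow}z$, $y\overset{\rho'}{\rightsquigarrow}z$; $x+y\xrightarrow{a}x'$ if $x\xrightarrow{a}x'$ and $y\overset{1}{\rightsquigarrow}y'$). $P(t,t')=\sum\{\pi\mid t\overset{\pi}{\rightsquigarrow}t'\}$, $P(t,T)=\sum_{t'\in T}P(t,t')$. A probabilistic bisimulation is an equivalence $R$ on closed terms such that $R(t_1,t_2)$ implies: every $t_1\xrightarrow{a}t_1'$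 is matched by some $t_2\xrightarrow{a}t_2'$ with $R(t_1',t_2')$; $t_1\downarrow a$ implies $t_2\downarrow a$; $P(t_1,[t]_R)=P(t_2,[t]_R)$ for all closed $t$. $t\leftrightarrow t'$ iff some probabilistic bisimulation relates them. *)

(* Defs.v *)
From HB Require Import structures.
From mathcomp Require Import all_boot all_order all_algebra.
From mathcomp Require Import boolp classical_sets fsbigop.
From mathcomp Require Import lra.

Set Implicit Arguments.
Unset Strict Implicit.
Unset Printing Implicit Defensive.

Import Order.TTheory GRing.Theory Num.Theory.
Local Open Scope ring_scope.
Local Open Scope classical_set_scope.

(** A nontrivial signed cancellation meadow is a totally ordered field whose
    inverse is made total by [0^-1 = 0]; this is MathComp's [realFieldType]
    (see [invr0]), with signum [Num.sg]. *)
Record prob (R : realFieldType) := Prob {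
  prob_val :> R;
  prob_valP : 0 <= prob_val <= 1 }.

HB.instance Definition _ (R : realFieldType) := [isSub for @prob_val R].
HB.instance Definition _ (R : realFieldType) := [Choice of prob R by <:].

Section ProbOps.
Variable R : realFieldType.
Implicit Types p q : prob R.

Lemma prob1_subproof : 0 <= (1 : R) <= 1.
Proof. by rewrite ler01 lexx. Qed.
Definition prob1 : prob R := Prob prob1_subproof.

Lemma probC_subproof p : 0 <= 1 - (p : R) <= 1.
Proof. by case: p => p /=; lra. Qed.
Definition probC p : prob R := Prob (probC_subproof p).

Lemma probM_subproof p q : 0 <= (p : R) * (q : R) <= 1.
Proof.
case: p q => [p /andP[p0 p1]] [q /andP[q0 q1]] /=.
by rewrite mulr_ge0 //= mulr_ile1.
Qed.
Definition probM p q : prob R := Prob (probM_subproof p q).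

Lemma probA_subproof p q :
  0 <= (1 - (p : R)) * (q : R) / (1 - (p : R) * (q : R)) <= 1.
Proof.
have /andP[_ pq1] := probM_subproof p q.
case: p q pq1 => [p /andP[p0 p1]] [q /andP[q0 q1]] /= pq1.
have [pqE|pqN] := eqVneq (p * q) 1.
  by rewrite pqE subrr invr0 mulr0 lexx ler01.
have d0 : 0 < 1 - p * q by rewrite subr_gt0 lt_neqAle pqN.
apply/andP; split; last by rewrite ler_pdivrMr //; lra.
by rewrite divr_ge0 ?mulr_ge0 ?subr_ge0 // ltW.
Qed.
(** [probA p q] is (1 - p) q / (1 - p q); it is 0 when [p q = 1]. *)
Definition probA p q : prob R := Prob (probA_subproof p q).

End ProbOps.
Arguments prob1 {R}.

(** Closed terms. [option A] is the set of actions extended with the inaction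
    constant: [Some a] is the action [a] and [None] is inaction. *)
Inductive term (A : Type) (R : realFieldType) : Type :=
| Cst of option A
| Alt of term A R & term A R
| Seq of term A R & term A R
| Pch of prob R & term A R & term A R
| Par of term A R & term A R
| Lmerge of term A R & term A R
| Cmerge of term A R & term A R
| Encap of set A & term A R.

Arguments Cst {A R} _.
Arguments Alt {A R} _ _.
Arguments Seq {A R} _ _.
Arguments Pch {A R} _ _ _.
Arguments Par {A R} _ _.
Arguments Lmerge {A R} _ _.
Arguments Cmerge {A R} _ _.
Arguments Encap {A R} _ _.

HB.instance Definition _ (A : Type) (R : realFieldType) :=
  gen_eqMixin (term A R).
HB.instance Definition _ (A : Type) (R : realFieldType) :=
  gen_choiceMixin (term A R).

Declare Scope pacp_scope.
Delimit Scope pacp_scope with pacp.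
Bind Scope pacp_scope with term.

Notation "⟨ a ⟩" := (Cst a) (at level 0, format "⟨ a ⟩") : pacp_scope.
Notation "'δ'" := (Cst None) : pacp_scope.
Notation "x + y" := (Alt x y) : pacp_scope.
Notation "x * y" := (Seq x y) : pacp_scope.
Notation "x <| p |> y" := (Pch p x y)
  (at level 49, right associativity, p at level 70) : pacp_scope.
Notation "x ∥ y" := (Par x y) (at level 45, no associativity) : pacp_scope.
Notation "x ⌊⌊ y" := (Lmerge x y) (at level 45, no associativity)
  : pacp_scope.
Notation "x ∣ y" := (Cmerge x y) (at level 45, no associativity)
  : pacp_scope.
Notation "'∂' H x" := (Encap H x) (at level 10, H at level 8, x at level 8)
  : pacp_scope.

Section Derivability.
Variables (A : Type) (gamma : option A -> option A -> option A).
Variable R : realFieldType.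

Reserved Notation "x ≡ y" (at level 70, no associativity).

(** Derivability of closed equations in conditional equational logic: the
    axioms enter through their closed instances. *)
Inductive derivable : term A R -> term A R -> Prop :=
| der_refl x : x ≡ x
| der_sym x y : x ≡ y -> y ≡ x
| der_trans x y z : x ≡ y -> y ≡ z -> x ≡ z
| cong_alt x x' y y' : x ≡ x' -> y ≡ y' -> x + y ≡ x' + y'
| cong_seq x x' y y' : x ≡ x' -> y ≡ y' -> x * y ≡ x' * y'
| cong_pch p x x' y y' : x ≡ x' -> y ≡ y' -> x <|p|> y ≡ x' <|p|> y'
| cong_par x x' y y' : x ≡ x' -> y ≡ y' -> x ∥ y ≡ x' ∥ y'
| cong_lmerge x x' y y' : x ≡ x' -> y ≡ y' -> x ⌊⌊ y ≡ x' ⌊⌊ y'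
| cong_cmerge x x' y y' : x ≡ x' -> y ≡ y' -> x ∣ y ≡ x' ∣ y'
| cong_encap H x x' : x ≡ x' -> ∂ H x ≡ ∂ H x'

| ax_altC x y : x + y ≡ y + x
| ax_altA x y z : (x + y) + z ≡ x + (y + z)
| ax_altI a : ⟨a⟩ + ⟨a⟩ ≡ ⟨a⟩
| ax_alt_seq x y z : (x + y) * z ≡ x * z + y * z
| ax_seqA x y z : (x * y) * z ≡ x * (y * z)
| ax_alt_delta x : x + δ ≡ x
| ax_delta_seq x : δ * x ≡ δ

| ax_encap_notin H a : ~ (Some @` H) a -> ∂ H ⟨a⟩ ≡ ⟨a⟩
| ax_encap_in H a : (Some @` H) a -> ∂ H ⟨a⟩ ≡ δ
| ax_encap_alt H x y : ∂ H (x + y) ≡ ∂ H x + ∂ H y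
| ax_encap_seq H x y : ∂ H (x * y) ≡ ∂ H x * ∂ H y
| ax_encap_pch H p x y : ∂ H (x <|p|> y) ≡ ∂ H x <|p|> ∂ H y

| ax_pchC p x y : x <|p|> y ≡ y <|probC p|> x
| ax_pchA p q x y z :
    (x <|p|> y) <|q|> z ≡ x <|probM p q|> (y <|probA p q|> z)
| ax_pchI p x : x <|p|> x ≡ x
| ax_pch_seq p x y z : (x <|p|> y) * z ≡ (x * z) <|p|> (y * z)
| ax_pch_alt p x y z : (x <|p|> y) + z ≡ (x + z) <|p|> (y + z)
| ax_pch1 x y : x <|prob1|> y ≡ x

| ax_par x y : x ≡ x + x -> y ≡ y + y ->
    x ∥ y ≡ (x ⌊⌊ y + y ⌊⌊ x) + (x ∣ y)
| ax_lmerge_cst a x : ⟨a⟩ ⌊⌊ x ≡ ⟨a⟩ * x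
| ax_lmerge_pre a x y : (⟨a⟩ * x) ⌊⌊ y ≡ ⟨a⟩ * (x ∥ y)
| ax_lmerge_alt x y z : (x + y) ⌊⌊ z ≡ x ⌊⌊ z + y ⌊⌊ z
| ax_cmerge_pre_cst a b x : (⟨a⟩ * x) ∣ ⟨b⟩ ≡ ⟨gamma a b⟩ * x
| ax_cmerge_cst_pre a b x : ⟨a⟩ ∣ (⟨b⟩ * x) ≡ ⟨gamma a b⟩ * x
| ax_cmerge_pre a b x y :
    (⟨a⟩ * x) ∣ (⟨b⟩ * y) ≡ ⟨gamma a b⟩ * (x ∥ y)
| ax_cmerge_altl x y z : (x + y) ∣ z ≡ (x ∣ z) + (y ∣ z)
| ax_cmerge_altr x y z : x ∣ (y + z) ≡ (x ∣ y) + (x ∣ z)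
| ax_cmerge_deltal x : δ ∣ x ≡ δ
| ax_cmerge_deltar x : x ∣ δ ≡ δ
| ax_cmerge_cst a b : ⟨a⟩ ∣ ⟨b⟩ ≡ ⟨gamma a b⟩

| ax_par_pchl p x y z : (x <|p|> y) ∥ z ≡ (x ∥ z) <|p|> (y ∥ z)
| ax_par_pchr p x y z : x ∥ (y <|p|> z) ≡ (x ∥ y) <|p|> (x ∥ z)
| ax_lmerge_pchl p x y z : (x <|p|> y) ⌊⌊ z ≡ (x ⌊⌊ z) <|p|> (y ⌊⌊ z)
| ax_lmerge_pchr p x y z : x ⌊⌊ (y <|p|> z) ≡ (x ⌊⌊ y) <|p|> (x ⌊⌊ z)
| ax_cmerge_pchl p x y z : (x <|p|> y) ∣ z ≡ (x ∣ z) <|p|> (y ∣ z)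
| ax_cmerge_pchr p x y z : x ∣ (y <|p|> z) ≡ (x ∣ y) <|p|> (x ∣ z)
where "x ≡ y" := (derivable x%pacp y%pacp).

End Derivability.

(** [ptrans x p z]: [x] behaves as [z] with probability [p]. The rules with
    label 0 cover the [z] that no resolution of the probabilistic choices of
    [x] can produce, so that every pair [(x, z)] has exactly one label; the
    rule for probabilistic choice relies on this, as it needs a label for [z]
    from both operands. *)
Section ProbabilisticTransitions.
Variables (A : Type) (R : realFieldType).

Reserved Notation "x ~[ p ]~> z" (at level 70, p at level 69).

Inductive ptrans : term A R -> R -> term A R -> Prop :=
| pt_cst a : ⟨a⟩ ~[ 1 ]~> ⟨a⟩
| pt_cst0 a z : z <> Cst a -> ⟨a⟩ ~[ 0 ]~> z
| pt_alt x y p q x' y' :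
    x ~[ p ]~> x' -> y ~[ q ]~> y' -> x + y ~[ p * q ]~> x' + y'
| pt_alt0 x y z : (forall x' y', z <> Alt x' y') -> x + y ~[ 0 ]~> z
| pt_seq x y p x' : x ~[ p ]~> x' -> x * y ~[ p ]~> x' * y
| pt_seq0 x y z : (forall x', z <> Seq x' y) -> x * y ~[ 0 ]~> z
| pt_pch (r : prob R) x y p q z :
    x ~[ p ]~> z -> y ~[ q ]~> z ->
    x <|r|> y ~[ (r : R) * p + (1 - (r : R)) * q ]~> z
| pt_par x y p q x' y' :
    x ~[ p ]~> x' -> y ~[ q ]~> y' -> x ∥ y ~[ p * q ]~> x' ∥ y'
| pt_par0 x y z : (forall x' y', z <> Par x' y') -> x ∥ y ~[ 0 ]~> z
| pt_lmerge x y p q x' y' :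
    x ~[ p ]~> x' -> y ~[ q ]~> y' -> x ⌊⌊ y ~[ p * q ]~> x' ⌊⌊ y'
| pt_lmerge0 x y z :
    (forall x' y', z <> Lmerge x' y') -> x ⌊⌊ y ~[ 0 ]~> z
| pt_cmerge x y p q x' y' :
    x ~[ p ]~> x' -> y ~[ q ]~> y' -> x ∣ y ~[ p * q ]~> x' ∣ y'
| pt_cmerge0 x y z :
    (forall x' y', z <> Cmerge x' y') -> x ∣ y ~[ 0 ]~> z
| pt_encap H x p x' : x ~[ p ]~> x' -> ∂ H x ~[ p ]~> ∂ H x'
| pt_encap0 H x z : (forall x', z <> Encap H x') -> ∂ H x ~[ 0 ]~> z
where "x ~[ p ]~> z" := (ptrans x%pacp p%R z%pacp).

(** [fsbigop] sums range over the finite support of the summand. *)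
Definition Pr (t t' : term A R) : R := \sum_(p \in [set p | ptrans t p t']) p.

Definition Pset (t : term A R) (T : set (term A R)) : R :=
  \sum_(t' \in T) Pr t t'.

End ProbabilisticTransitions.

(** Premises [ptrans y 1 y'] express that the probabilistic choices of [y] are
    resolved. A probabilistic choice that resolves to [z] with probability 1
    performs the actions of [z]. *)
Section ActionTransitions.
Variables (A : Type) (gamma : option A -> option A -> option A).
Variable R : realFieldType.

Reserved Notation "x ↓ a" (at level 70, no associativity).
Reserved Notation "x -[ a ]-> z" (at level 70, a at level 69).

Inductive terminates : term A R -> A -> Prop :=
| tm_cst a : ⟨Some a⟩ ↓ a
| tm_altl x y y' a : x ↓ a -> ptrans y 1 y' -> x + y ↓ a
| tm_altr x x' y a : ptrans x 1 x' -> y ↓ a -> x + y ↓ a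
| tm_pch p x y z a : ptrans (Pch p x y) 1 z -> z ↓ a -> x <|p|> y ↓ a
| tm_par x y a b c :
    x ↓ a -> y ↓ b -> gamma (Some a) (Some b) = Some c -> x ∥ y ↓ c
| tm_cmerge x y a b c :
    x ↓ a -> y ↓ b -> gamma (Some a) (Some b) = Some c -> x ∣ y ↓ c
| tm_encap H x a : x ↓ a -> ~ H a -> ∂ H x ↓ a
where "x ↓ a" := (terminates x%pacp a).

Inductive trans : term A R -> A -> term A R -> Prop :=
| tr_altl x y x' y' a : x -[ a ]-> x' -> ptrans y 1 y' -> x + y -[ a ]-> x'
| tr_altr x y x' y' a : ptrans x 1 x' -> y -[ a ]-> y' -> x + y -[ a ]-> y'
| tr_seq_term x y a : terminates x a -> x * y -[ a ]-> y
| tr_seq x y x' a : x -[ a ]-> x' -> x * y -[ a ]-> x' * y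
| tr_pch p x y z z' a :
    ptrans (Pch p x y) 1 z -> z -[ a ]-> z' -> x <|p|> y -[ a ]-> z'
| tr_parl_term x y y' a :
    terminates x a -> ptrans y 1 y' -> x ∥ y -[ a ]-> y
| tr_parr_term x x' y a :
    ptrans x 1 x' -> terminates y a -> x ∥ y -[ a ]-> x
| tr_parl x y x' y' a :
    x -[ a ]-> x' -> ptrans y 1 y' -> x ∥ y -[ a ]-> x' ∥ y
| tr_parr x y x' y' a :
    ptrans x 1 x' -> y -[ a ]-> y' -> x ∥ y -[ a ]-> x ∥ y'
| tr_par_terml x y y' a b c :
    terminates x a -> y -[ b ]-> y' -> gamma (Some a) (Some b) = Some c ->
    x ∥ y -[ c ]-> y'
| tr_par_termr x y x' a b c :
    x -[ a ]-> x' -> terminates y b -> gamma (Some a) (Some b) = Some c ->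
    x ∥ y -[ c ]-> x'
| tr_par x y x' y' a b c :
    x -[ a ]-> x' -> y -[ b ]-> y' -> gamma (Some a) (Some b) = Some c ->
    x ∥ y -[ c ]-> x' ∥ y'
| tr_lmerge_term x y y' a :
    terminates x a -> ptrans y 1 y' -> x ⌊⌊ y -[ a ]-> y
| tr_lmerge x y x' y' a :
    x -[ a ]-> x' -> ptrans y 1 y' -> x ⌊⌊ y -[ a ]-> x' ∥ y
| tr_cmerge_terml x y y' a b c :
    terminates x a -> y -[ b ]-> y' -> gamma (Some a) (Some b) = Some c ->
    x ∣ y -[ c ]-> y'
| tr_cmerge_termr x y x' a b c :
    x -[ a ]-> x' -> terminates y b -> gamma (Some a) (Some b) = Some c ->
    x ∣ y -[ c ]-> x'
| tr_cmerge x y x' y' a b c :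
    x -[ a ]-> x' -> y -[ b ]-> y' -> gamma (Some a) (Some b) = Some c ->
    x ∣ y -[ c ]-> x' ∥ y'
| tr_encap H x x' a : x -[ a ]-> x' -> ~ H a -> ∂ H x -[ a ]-> ∂ H x'
where "x -[ a ]-> z" := (trans x%pacp a z%pacp).

Record prob_bisimulation (B : term A R -> term A R -> Prop) : Prop :=
  ProbBisimulation {
    pb_refl : forall t, B t t;
    pb_sym : forall t1 t2, B t1 t2 -> B t2 t1;
    pb_trans : forall t1 t2 t3, B t1 t2 -> B t2 t3 -> B t1 t3;
    pb_act : forall t1 t2 a t1', B t1 t2 -> trans t1 a t1' ->
      exists2 t2', trans t2 a t2' & B t1' t2';
    pb_term : forall t1 t2 a, B t1 t2 -> terminates t1 a -> terminates t2 a;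
    pb_prob : forall t1 t2 t, B t1 t2 ->
      Pset t1 [set u | B t u] = Pset t2 [set u | B t u] }.

Definition bisimilar (t t' : term A R) : Prop :=
  exists2 B, prob_bisimulation B & B t t'.

End ActionTransitions.

(* Main.v *)
(** Distributing the operators over probabilistic choice rewrites a term [t] to
    a convex combination of resolved terms, whose weights are exactly the
    probabilities of [t]. Expanding merges rewrites a resolved term to the sum of
    [a] and [a * u] over its terminations and transitions. Residuals have fewer
    leaves, so by induction bisimilar resolved terms have derivably equal
    summands, hence absorb each other and are derivably equal; two bisimilar
    terms then give convex combinations with equal weights on each bisimulation
    class. Bisimilarity is never transferred along derivability, so soundness of
    the axioms plays no role. *)

From Stdlib Require Import Setoid Morphisms.
Require Import Defs.
From HB Require Import structures.
From mathcomp Require Import all_boot all_order all_algebra.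
From mathcomp Require Import boolp classical_sets fsbigop.
From mathcomp Require Import ring lra.

Set Implicit Arguments.
Unset Strict Implicit.
Unset Printing Implicit Defensive.

Import Order.TTheory GRing.Theory Num.Theory.
Local Open Scope ring_scope.

(** * Weighted lists of terms *)

Section WeightedLists.
Variables (A : Type) (R : realFieldType).
Notation term := (term A R).
Implicit Types (l : seq (R * term)) (P : pred term) (op : term -> term -> term).

Definition weight P l : R := \sum_(i <- l | P i.2) i.1.
Definition mass l : R := weight predT l.
Definition nonneg l := all (fun i => 0 <= i.1) l.

Definition scale (c : R) l := [seq (c * i.1, i.2) | i <- l].
Definition wmap (f : term -> term) l := [seq (i.1, f i.2) | i <- l].
Definition wprod op l l' := flatten [seq scale i.1 (wmap (op i.2) l') | i <- l].

Lemma weight_cons P i l :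
  weight P (i :: l) = (if P i.2 then i.1 else 0) + weight P l.
Proof. by rewrite /weight big_cons; case: ifP; rewrite ?add0r. Qed.

Lemma mass_cons i l : mass (i :: l) = i.1 + mass l.
Proof. by rewrite /mass weight_cons. Qed.

Lemma mass_nil : mass [::] = 0.
Proof. by rewrite /mass /weight big_nil. Qed.

Lemma weight_cat P l l' : weight P (l ++ l') = weight P l + weight P l'.
Proof. by rewrite /weight big_cat. Qed.

Lemma weight_scale P c l : weight P (scale c l) = c * weight P l.
Proof. by rewrite /weight big_map /= big_distrr. Qed.

Lemma weight_wmap P f l : weight P (wmap f l) = weight (P \o f) l.
Proof. by rewrite /weight big_map. Qed.

Lemma weight_wprod P op l l' :
  weight P (wprod op l l') = \sum_(i <- l) i.1 * weight (P \o op i.2) l'.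
Proof.
elim: l => [|i l IH]; first by rewrite big_nil /wprod /weight big_nil.
by rewrite /wprod /= weight_cat big_cons -IH weight_scale weight_wmap.
Qed.

Lemma weight0 P l : (forall u, ~~ P u) -> weight P l = 0.
Proof. by move=> P0; rewrite /weight big_pred0 // => i; apply/negbTE/P0. Qed.

Lemma mass_wprod op l l' : mass (wprod op l l') = mass l * mass l'.
Proof. by rewrite /mass weight_wprod big_distrl. Qed.

Lemma weight_wprod_inj op l l' x y :
  (forall u v, op u v = op x y -> u = x /\ v = y) ->
  weight (pred1 (op x y)) (wprod op l l') =
  weight (pred1 x) l * weight (pred1 y) l'.
Proof.
move=> opI; rewrite weight_wprod /weight big_distrl /= [RHS]big_mkcond /=.
apply: eq_bigr => i _; case: eqP => [->|ix].
  congr (_ * _); apply: eq_bigl => j /=.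
  by apply/eqP/eqP => [/opI[]|->].
by rewrite big_pred0 ?mulr0 // => j /=; apply/eqP => /opI[].
Qed.

Lemma mass_ge0 l : nonneg l -> 0 <= mass l.
Proof.
elim: l => [|i l IH /= /andP[? /IH ?]]; rewrite ?mass_nil ?mass_cons //.
exact: addr_ge0.
Qed.

Lemma nonneg_cat l l' : nonneg (l ++ l') = nonneg l && nonneg l'.
Proof. exact: all_cat. Qed.

Lemma nonneg_scale c l : 0 <= c -> nonneg l -> nonneg (scale c l).
Proof. by move=> c0; rewrite /nonneg all_map; apply: sub_all => i; exact: mulr_ge0. Qed.

Lemma nonneg_wmap f l : nonneg (wmap f l) = nonneg l.
Proof. by rewrite /nonneg all_map. Qed.

Lemma nonneg_wprod op l l' : nonneg l -> nonneg l' -> nonneg (wprod op l l').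
Proof.
move=> + nl'; elim: l => //= i l IH /andP[i0 /IH nl].
by rewrite /wprod /= nonneg_cat nl nonneg_scale // nonneg_wmap.
Qed.

Lemma weight_filter P Q l : weight P [seq i <- l | Q i.2] = weight (predI Q P) l.
Proof. by rewrite /weight big_filter_cond. Qed.

Lemma mass_filter P l : mass [seq i <- l | P i.2] = weight P l.
Proof. by rewrite /mass weight_filter; apply: eq_bigl => i /=; rewrite andbT. Qed.

Lemma mass_split P l : mass l = weight P l + weight (predC P) l.
Proof. by rewrite /mass /weight (bigID (fun i => P i.2)). Qed.

Lemma nonneg_filter P l : nonneg l -> nonneg [seq i <- l | P i.2].
Proof. by move=> /allP nl; apply/allP => i; rewrite mem_filter => /andP[_ /nl]. Qed.

Lemma mem_wfilter P l (z : term) :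
  z \in unzip2 [seq i <- l | P i.2] -> P z /\ z \in unzip2 l.
Proof.
move=> /mapP[i]; rewrite mem_filter => /andP[Pi il] ->; split => //.
by apply/mapP; exists i.
Qed.

Lemma mem_wmap f l (z : term) :
  z \in unzip2 (wmap f l) -> exists2 x, x \in unzip2 l & z = f x.
Proof.
move=> /mapP[_ /mapP[i il ->] ->] /=.
by exists i.2 => //; apply/mapP; exists i.
Qed.

Lemma mem_wprod op l l' (z : term) : z \in unzip2 (wprod op l l') ->
  exists x y, [/\ x \in unzip2 l, y \in unzip2 l' & z = op x y].
Proof.
move=> /mapP[j /flattenP[_ /mapP[i il ->] /mapP[_ /mapP[k kl ->] ->]] ->] /=.
by exists i.2, k.2; split => //; apply/mapP; [exists i|exists k].
Qed.

End WeightedLists.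

(** * Resolution of probabilistic choices *)

Section Resolution.
Variables (A : Type) (R : realFieldType).
Notation term := (term A R).

Fixpoint dist (t : term) : seq (R * term) :=
  match t with
  | Cst a => [:: (1, Cst a)]
  | Alt x y => wprod Alt (dist x) (dist y)
  | Seq x y => wmap (Seq^~ y) (dist x)
  | Pch r x y => scale r (dist x) ++ scale (1 - (r : R)) (dist y)
  | Par x y => wprod Par (dist x) (dist y)
  | Lmerge x y => wprod Lmerge (dist x) (dist y)
  | Cmerge x y => wprod Cmerge (dist x) (dist y)
  | Encap H x => wmap (Encap H) (dist x)
  end.

Fixpoint resolved (t : term) : bool :=
  match t with
  | Cst _ => true
  | Pch _ _ _ => false
  | Seq x _ | Encap _ x => resolved x
  | Alt x y | Par x y | Lmerge x y | Cmerge x y => resolved x && resolved y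
  end.

Fixpoint leaves (t : term) : nat :=
  match t with
  | Cst _ => 1
  | Encap _ x => leaves x
  | Alt x y | Seq x y | Pch _ x y | Par x y | Lmerge x y | Cmerge x y =>
      leaves x + leaves y
  end.

Lemma leaves_gt0 t : (0 < leaves t)%N.
Proof. by elim: t => //= *; rewrite addn_gt0; apply/orP; left. Qed.

Lemma nonneg_dist t : nonneg (dist t).
Proof.
elim: t => //= [a|x IHx y IHy|x IHx y _|r x IHx y IHy|x IHx y IHy|x IHx y IHy
  |x IHx y IHy|H x IHx]; rewrite ?nonneg_wmap ?nonneg_wprod //.
- by rewrite /nonneg /= ler01.
- by case: r => r /= /andP[r0 r1]; rewrite nonneg_cat !nonneg_scale ?subr_ge0.
Qed.

Lemma mass_dist t : mass (dist t) = 1.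
Proof.
elim: t => //= [a|x IHx y IHy|x IHx y _|r x IHx y IHy|x IHx y IHy|x IHx y IHy
  |x IHx y IHy|H x IHx]; rewrite ?mass_wprod ?IHx ?IHy ?mulr1 //.
- by rewrite mass_cons mass_nil addr0.
- by rewrite /mass weight_wmap; exact: IHx.
- rewrite /mass weight_cat !weight_scale -!/(mass _) IHx IHy; lra.
- by rewrite /mass weight_wmap; exact: IHx.
Qed.

Lemma mem_distP t z :
  z \in unzip2 (dist t) -> resolved z /\ (leaves z <= leaves t)%N.
Proof.
elim: t z => /= [a|x IHx y IHy|x IHx y _|r x IHx y IHy|x IHx y IHy|x IHx y IHy
  |x IHx y IHy|H x IHx] z;
  try by move=> /mem_wprod[u [v [/IHx[ru lu] /IHy[rv lv] ->]]] /=;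
    rewrite ru rv leq_add.
- by rewrite inE => /eqP ->.
- by move=> /mem_wmap[u /IHx[ru lu] ->] /=; rewrite ru leq_add2r.
- rewrite /unzip2 map_cat mem_cat -!map_comp => /orP[/IHx|/IHy] [-> lz]; split => //.
    exact: leq_trans lz (leq_addr _ _).
  exact: leq_trans lz (leq_addl _ _).
- by move=> /mem_wmap[u /IHx[ru lu] ->].
Qed.

Lemma ptrans_resolved z : resolved z -> ptrans z 1 z.
Proof.
elim: z => //= [a _|x IHx y IHy|x IHx y _|x IHx y IHy|x IHx y IHy
  |x IHx y IHy|H x IHx].
- exact: pt_cst.
- by case/andP=> /IHx px /IHy py; rewrite -[1]mulr1; exact: pt_alt.
- by move=> /IHx; exact: pt_seq.
- by case/andP=> /IHx px /IHy py; rewrite -[1]mulr1; exact: pt_par.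
- by case/andP=> /IHx px /IHy py; rewrite -[1]mulr1; exact: pt_lmerge.
- by case/andP=> /IHx px /IHy py; rewrite -[1]mulr1; exact: pt_cmerge.
- by move=> /IHx; exact: pt_encap.
Qed.

Lemma weight_wprod_neq (op : term -> term -> term) l l' z :
  (forall x y, z <> op x y) -> weight (pred1 z) (wprod op l l') = 0.
Proof.
move=> zop; rewrite weight_wprod big1 // => i _; rewrite weight0 ?mulr0 // => u.
by apply/eqP => /= /esym/zop.
Qed.

Lemma weight_wmap_inj f (l : seq (R * term)) x : injective f ->
  weight (pred1 (f x)) (wmap f l) = weight (pred1 x) l.
Proof.
move=> fI; rewrite weight_wmap; apply: eq_bigl => i /=.
by rewrite (inj_eq fI).
Qed.

Lemma weight_wmap_neq f (l : seq (R * term)) z :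
  (forall x, z <> f x) -> weight (pred1 z) (wmap f l) = 0.
Proof.
move=> zf; rewrite weight_wmap weight0 // => u.
by apply/eqP => /= /esym/zf.
Qed.

Lemma ptrans_weight t p z : ptrans t p z -> p = weight (pred1 z) (dist t).
Proof.
elim=> {t p z} /=.
- by move=> a; rewrite weight_cons /weight big_nil /= eqxx addr0.
- move=> a z za; rewrite weight_cons /weight big_nil /= addr0.
  by case: eqP => // /esym.
- by move=> x y p q x' y' _ -> _ ->; rewrite weight_wprod_inj // => u v [].
- by move=> x y z zN; rewrite weight_wprod_neq.
- move=> x y p x' _ ->; rewrite (@weight_wmap_inj (Seq^~ y)) //.
  by move=> u v [].
- by move=> x y z zN; rewrite weight_wmap_neq.
- by move=> r x y p q z _ -> _ ->; rewrite weight_cat !weight_scale.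
- by move=> x y p q x' y' _ -> _ ->; rewrite weight_wprod_inj // => u v [].
- by move=> x y z zN; rewrite weight_wprod_neq.
- by move=> x y p q x' y' _ -> _ ->; rewrite weight_wprod_inj // => u v [].
- by move=> x y z zN; rewrite weight_wprod_neq.
- by move=> x y p q x' y' _ -> _ ->; rewrite weight_wprod_inj // => u v [].
- by move=> x y z zN; rewrite weight_wprod_neq.
- move=> H x p x' _ ->; rewrite weight_wmap_inj //.
  by move=> u v [].
- by move=> H x z zN; rewrite weight_wmap_neq.
Qed.

Lemma ex_ptrans (t z : term) : exists p, ptrans t p z.
Proof.
elim: t z => /= [a|x IHx y IHy|x IHx y _|r x IHx y IHy|x IHx y IHy|x IHx y IHy
  |x IHx y IHy|H x IHx] z.
- have [->|za] := pselect (z = Cst a); first by exists 1; exact: pt_cst.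
  by exists 0; exact: pt_cst0.
- have [[u [v ->]]|zN] := pselect (exists u v, z = Alt u v).
    by have [[p ?] [q ?]] := (IHx u, IHy v); exists (p * q); exact: pt_alt.
  by exists 0; apply: pt_alt0 => u v zE; apply: zN; exists u, v.
- have [[u ->]|zN] := pselect (exists u, z = Seq u y).
    by have [p ?] := IHx u; exists p; exact: pt_seq.
  by exists 0; apply: pt_seq0 => u zE; apply: zN; exists u.
- have [[p ?] [q ?]] := (IHx z, IHy z).
  by exists ((r : R) * p + (1 - (r : R)) * q); exact: pt_pch.
- have [[u [v ->]]|zN] := pselect (exists u v, z = Par u v).
    by have [[p ?] [q ?]] := (IHx u, IHy v); exists (p * q); exact: pt_par.
  by exists 0; apply: pt_par0 => u v zE; apply: zN; exists u, v.
- have [[u [v ->]]|zN] := pselect (exists u v, z = Lmerge u v).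
    by have [[p ?] [q ?]] := (IHx u, IHy v); exists (p * q); exact: pt_lmerge.
  by exists 0; apply: pt_lmerge0 => u v zE; apply: zN; exists u, v.
- have [[u [v ->]]|zN] := pselect (exists u v, z = Cmerge u v).
    by have [[p ?] [q ?]] := (IHx u, IHy v); exists (p * q); exact: pt_cmerge.
  by exists 0; apply: pt_cmerge0 => u v zE; apply: zN; exists u, v.
- have [[u ->]|zN] := pselect (exists u, z = Encap H u).
    by have [p ?] := IHx u; exists p; exact: pt_encap.
  by exists 0; apply: pt_encap0 => u zE; apply: zN; exists u.
Qed.

Lemma PrE t z : Pr t z = weight (pred1 z) (dist t).
Proof.
rewrite /Pr (_ : [set p | _] = [set weight (pred1 z) (dist t)])%classic.
  by rewrite fsbig_set1.
apply/seteqP; split => [p /= /ptrans_weight //|_ /= ->].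
by have [p tp] := ex_ptrans t z; rewrite -(ptrans_weight tp).
Qed.

Lemma PsetE t (T : set term) :
  Pset t T = weight (fun u => `[< T u >]) (dist t).
Proof.
rewrite /Pset; set s := undup (unzip2 (dist t)).
rewrite (fsbigE [seq u <- s | `[< T u >]]) ?filter_uniq ?undup_uniq //; last 2 first.
- by move=> u /=; rewrite mem_filter => /andP[/asboolP].
- move=> u Tu; rewrite mem_filter asboolT //= mem_undup => us.
  rewrite PrE /weight big_seq_cond big1 // => i /andP[il /eqP iu].
  by case/negP: us; rewrite -iu; apply/mapP; exists i.
rewrite big_filter_cond.
under eq_bigr do rewrite PrE /weight big_mkcond.
rewrite exchange_big /weight [RHS]big_mkcond /= big_seq [RHS]big_seq.
apply: eq_bigr => i il.
have is_ : i.2 \in s by rewrite mem_undup; apply/mapP; exists i.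
rewrite big_mkcond (bigD1_seq i.2) ?undup_uniq //= eqxx big1 ?addr0.
  by case: asboolP => //= Ti; rewrite mem_set.
by move=> u ui; rewrite eq_sym (negbTE ui) if_same.
Qed.

End Resolution.

(** * Convex combinations up to derivability *)

#[local] Instance derivable_equivalence (A : Type)
    (gamma : option A -> option A -> option A) (R : realFieldType) :
  Equivalence (@derivable A gamma R).
Proof.
by split; [exact: der_refl | exact: der_sym | exact: der_trans].
Qed.

Section ConvexCombinations.
Variables (A : Type) (gamma : option A -> option A -> option A).
Variable R : realFieldType.
Notation term := (term A R).
Notation "x ≡ y" := (@derivable A gamma R x y) (at level 70, no associativity).
Implicit Types (x y z : term) (l : seq (R * term)).

#[local] Instance pch_proper p :
  Proper (@derivable A gamma R ==> @derivable A gamma R ==> @derivable A gamma R)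
    (@Pch A R p).
Proof. by move=> x x' xx' y y' yy'; exact: cong_pch. Qed.

(* [ratio 0 0] is 0. *)
Definition ratio (a b : R) : prob R := insubd prob1 (a / (a + b)).

Definition wch (a b : R) x y := Pch (ratio a b) x y.

Lemma ratioE (a b : R) : 0 <= a -> 0 <= b -> ratio a b = a / (a + b) :> R.
Proof.
move=> a0 b0; apply: (@insubdK _ _ (prob R)); rewrite -topredE /=.
have [->|a1] := eqVneq a 0; first by rewrite mul0r lexx ler01.
have ab : 0 < a + b by rewrite ltr_wpDr // lt0r a1.
by rewrite ler_pdivrMr // mul1r lerDl b0 divr_ge0 // ltW.
Qed.

Lemma probC_ratio (a b : R) : 0 <= a -> 0 <= b -> 0 < a + b ->
  probC (ratio a b) = ratio b a.
Proof.
move=> a0 b0 ab; apply: val_inj; rewrite /= !ratioE // [b + a]addrC.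
have abN : a + b != 0 by rewrite gt_eqF.
by field.
Qed.

Lemma probM_ratio (a b c : R) : 0 <= a -> 0 <= b -> 0 <= c ->
  probM (ratio a b) (ratio (a + b) c) = ratio a (b + c).
Proof.
move=> a0 b0 c0; apply: val_inj; rewrite /= !ratioE ?addr_ge0 // addrA.
have [ab|abN] := eqVneq (a + b) 0; last by rewrite mulrA divfK.
by rewrite (_ : a = 0) ?mul0r //; lra.
Qed.

Lemma probA_ratio (a b c : R) : 0 <= a -> 0 <= b -> 0 <= c ->
  probA (ratio a b) (ratio (a + b) c) = ratio b c.
Proof.
move=> a0 b0 c0; apply: val_inj; rewrite /= !ratioE ?addr_ge0 //.
have [ab|abN] := eqVneq (a + b) 0.
  by rewrite ab (_ : b = 0) ?(mul0r, mulr0) //; lra.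
have ab0 : 0 < a + b by rewrite lt0r abN addr_ge0.
have abcN : a + b + c != 0 by rewrite gt_eqF // ltr_wpDr.
have [bc|bcN] := eqVneq (b + c) 0.
  have bE : b = 0 by lra.
  move: abN; rewrite bE mul0r addr0 => aN.
  by rewrite divff // subrr !mul0r.
have -> : 1 - a / (a + b) = b / (a + b) by field.
have -> : b / (a + b) * ((a + b) / (a + b + c)) = b / (a + b + c).
  by rewrite mulrA divfK.
have -> : 1 - a / (a + b) * ((a + b) / (a + b + c)) = (b + c) / (a + b + c).
  by field; rewrite abN abcN.
by field; rewrite bcN abcN.
Qed.

Lemma wchC (a b : R) x y : 0 <= a -> 0 <= b -> 0 < a + b ->
  wch a b x y ≡ wch b a y x.
Proof. by move=> *; rewrite /wch -(@probC_ratio a b) //; exact: ax_pchC. Qed.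

Lemma wchA (a b c : R) x y z : 0 <= a -> 0 <= b -> 0 <= c ->
  wch (a + b) c (wch a b x y) z ≡ wch a (b + c) x (wch b c y z).
Proof.
move=> a0 b0 c0; rewrite /wch -(probM_ratio a0 b0 c0) -(probA_ratio a0 b0 c0).
exact: ax_pchA.
Qed.

Lemma wch0l (b : R) x y : wch 0 b x y ≡ y.
Proof.
rewrite /wch ax_pchC (_ : probC _ = prob1); first exact: ax_pch1.
have p0 : ratio 0 b = 0 :> R.
  by rewrite /ratio mul0r; apply: (@insubdK _ _ (prob R)); rewrite -topredE /= lexx ler01.
by apply: val_inj; rewrite /= p0 subr0.
Qed.

Lemma wch0r (a : R) x y : 0 < a -> wch a 0 x y ≡ x.
Proof. by move=> a0; rewrite wchC ?addr0 ?(ltW a0) //; exact: wch0l. Qed.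

Lemma wch_cong (a b : R) x x' y y' : 0 <= a -> 0 <= b -> 0 < a + b ->
  (0 < a -> x ≡ x') -> (0 < b -> y ≡ y') -> wch a b x y ≡ wch a b x' y'.
Proof.
move=> a0 b0 ab xx' yy'.
have [aE|aN] := eqVneq a 0.
  rewrite aE !wch0l; apply: yy'; lra.
have [bE|bN] := eqVneq b 0.
  by rewrite bE !wch0r ?lt0r ?aN //; apply: xx'; rewrite lt0r aN.
by rewrite /wch xx' ?yy' ?lt0r ?aN ?bN //; reflexivity.
Qed.

Lemma wchCA (a b c : R) x y z : 0 <= a -> 0 <= b -> 0 <= c ->
  wch a (b + c) x (wch b c y z) ≡ wch b (a + c) y (wch a c x z).
Proof.
move=> a0 b0 c0; have [ab|abN] := eqVneq (a + b) 0.
  have -> : a = 0 by lra.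
  have -> : b = 0 by lra.
  by rewrite !wch0l; reflexivity.
have ab0 : 0 < a + b by rewrite lt0r abN addr_ge0.
apply: der_trans (der_sym (wchA _ _ _ a0 b0 c0)) _.
apply: der_trans _ (wchA _ _ _ b0 a0 c0); rewrite [b + a]addrC.
by apply: cong_pch; [exact: wchC|exact: der_refl].
Qed.

Fixpoint psum l : term :=
  if l is i :: l' then wch i.1 (mass l') i.2 (psum l') else Cst None.

Lemma psum_cat l l' : nonneg l -> nonneg l' ->
  psum (l ++ l') ≡ wch (mass l) (mass l') (psum l) (psum l').
Proof.
move=> + nl'; elim: l => [_|i l IH /= /andP[i0 nl]].
  by rewrite /= mass_nil wch0l; reflexivity.
rewrite {1}/mass weight_cat {1}/wch IH // mass_cons wchA ?mass_ge0 //.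
exact: der_refl.
Qed.

Lemma psum_split (P : pred term) l : nonneg l ->
  psum l ≡ wch (weight P l) (weight (predC P) l)
    (psum [seq i <- l | P i.2]) (psum [seq i <- l | ~~ P i.2]).
Proof.
elim: l => [_|i l IH /= /andP[i0 nl]] /=; first by rewrite /wch ax_pchI; reflexivity.
rewrite {1}/wch IH // -/(wch _ _ _ _) (mass_split P) !weight_cons /=.
have w0 Q : 0 <= weight Q l by rewrite -mass_filter mass_ge0 ?nonneg_filter.
case: ifP => Pi /=; rewrite ?mass_filter ?add0r.
  by rewrite wchA ?w0 //; reflexivity.
by rewrite wchCA ?w0 // (mass_filter (predC P)); reflexivity.
Qed.

Lemma psum_cong l (f g : term -> term) : nonneg l ->
  {in unzip2 l, forall z, f z ≡ g z} -> psum (wmap f l) ≡ psum (wmap g l).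
Proof.
elim: l => [|i l IH] //= => [*|/andP[i0 nl] fg]; first exact: der_refl.
have t h : mass (wmap h l) = mass l by rewrite /mass weight_wmap.
rewrite !t /wch fg ?mem_head //; apply: cong_pch; first exact: der_refl.
by apply: IH => // z zl; apply: fg; rewrite inE zl orbT.
Qed.

Lemma psum_const l z : nonneg l -> 0 < mass l ->
  {in unzip2 l, forall u, u ≡ z} -> psum l ≡ z.
Proof.
elim: l => [|i l IH] /=; first by rewrite mass_nil ltxx.
rewrite mass_cons => /andP[i0 nl] t0 lz.
rewrite (@wch_cong _ _ _ z _ z) ?mass_ge0 //.
- exact: ax_pchI.
- by move=> _; apply: lz; rewrite mem_head.
- by move=> tl; apply: IH => // u ul; apply: lz; rewrite inE ul orbT.
Qed.

Lemma psum_map (f : term -> term) l :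
  (forall x y, x ≡ y -> f x ≡ f y) ->
  (forall p x y, f (x <|p|> y)%pacp ≡ f x <|p|> f y) ->
  nonneg l -> 0 < mass l -> f (psum l) ≡ psum (wmap f l).
Proof.
move=> fC fP; elim: l => [|i l IH] /=; first by rewrite mass_nil ltxx.
rewrite mass_cons => /andP[i0 nl] t0.
rewrite [mass (wmap _ _)](weight_wmap predT) -/(mass l).
rewrite {1}/wch fP -/(wch _ _ _ _); apply: wch_cong => //.
- exact: mass_ge0.
- by move=> _; exact: der_refl.
- by move=> tl; exact: IH.
Qed.

Lemma psum_scale (c : R) l : 0 < c -> psum (scale c l) = psum l.
Proof.
move=> c0; elim: l => //= i l ->; rewrite /wch.
rewrite [mass (scale _ _)]weight_scale -/(mass l) /ratio -mulrDr.
by rewrite -mulf_div divff ?gt_eqF // mul1r.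
Qed.

Lemma psum_bind (f : term -> term) (g : term -> seq (R * term)) l :
  (forall z, nonneg (g z)) -> (forall z, mass (g z) = 1) ->
  (forall z, f z ≡ psum (g z)) -> nonneg l ->
  psum (wmap f l) ≡ psum (flatten [seq scale i.1 (g i.2) | i <- l]).
Proof.
move=> ng tg fg; elim: l => [|i l IH] /=; first by move=> _; exact: der_refl.
move=> /andP[i0 nl]; set m := flatten _ in IH *.
have nm : nonneg m.
  apply/allP => j /flattenP[_ /mapP[k kl ->]].
  exact: (allP (nonneg_scale (allP nl _ kl) (ng k.2))).
have tm : mass m = mass l.
  rewrite /m; elim: (l) => //= k l' IH'.
  by rewrite /mass weight_cat weight_scale -!/(mass _) IH' tg mulr1 mass_cons.
rewrite psum_cat ?nonneg_scale // [mass (scale _ _)]weight_scale -/(mass _) tg mulr1.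
rewrite tm [mass (wmap _ _)](weight_wmap predT) -/(mass l).
have [->|iN] := eqVneq i.1 0; first by rewrite !wch0l; exact: IH.
rewrite psum_scale ?lt0r ?iN //.
by apply: cong_pch; [exact: fg|exact: IH].
Qed.

Lemma psum_wprod (op : term -> term -> term) l l' :
  (forall x x' y y', x ≡ x' -> y ≡ y' -> op x y ≡ op x' y') ->
  (forall p x y z, op (x <|p|> y)%pacp z ≡ op x z <|p|> op y z) ->
  (forall p x y z, op x (y <|p|> z)%pacp ≡ op x y <|p|> op x z) ->
  nonneg l -> nonneg l' -> mass l = 1 -> mass l' = 1 ->
  op (psum l) (psum l') ≡ psum (wprod op l l').
Proof.
move=> opC opl opr nl nl' tl tl'.
have opCl z x y : x ≡ y -> op x z ≡ op y z.
  by move=> xy; apply: opC => //; exact: der_refl.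
have opCr z x y : x ≡ y -> op z x ≡ op z y.
  by move=> xy; apply: opC => //; exact: der_refl.
rewrite (@psum_map (op^~ (psum l'))) ?tl ?ltr01 //; last first.
- by move=> x y; exact: opCl.
apply: (@psum_bind (op^~ (psum l')) (fun z => wmap (op z) l')) => // z.
- by rewrite nonneg_wmap.
- by rewrite [LHS](weight_wmap predT).
- by apply: psum_map; rewrite ?tl' ?ltr01 // => x y; exact: opCr.
Qed.

Lemma psum_dist (t : term) : t ≡ psum (dist t).
Proof.
elim: t => [a|x IHx y IHy|x IHx y _|r x IHx y IHy|x IHx y IHy|x IHx y IHy
  |x IHx y IHy|H x IHx] /=.
- by rewrite mass_nil wch0r ?ltr01 //; reflexivity.
- apply: der_trans (cong_alt IHx IHy) _.
  apply: psum_wprod; rewrite ?mass_dist ?nonneg_dist //.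
  + exact: cong_alt.
  + exact: ax_pch_alt.
  + move=> p u v w; rewrite ax_altC ax_pch_alt.
    by apply: cong_pch; exact: ax_altC.
- apply: der_trans (cong_seq IHx (der_refl _ _)) _.
  apply: (@psum_map (Seq^~ y)); rewrite ?mass_dist ?nonneg_dist ?ltr01 //.
  + by move=> u v uv; apply: cong_seq => //; exact: der_refl.
  + by move=> *; exact: ax_pch_seq.
- have [r0 r1] : 0 <= (r : R) /\ 0 <= 1 - (r : R) by case: r => r /=; lra.
  rewrite psum_cat ?nonneg_scale ?nonneg_dist //.
  rewrite ![mass (scale _ _)]weight_scale -!/(mass _) !mass_dist !mulr1.
  have -> : (x <|r|> y)%pacp = wch r (1 - (r : R)) x y.
    rewrite /wch; congr Pch; apply: val_inj; rewrite /= ratioE //.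
    by rewrite addrC subrK divr1.
  apply: wch_cong => //; first lra.
  + by move=> r2; rewrite psum_scale.
  + by move=> r2; rewrite psum_scale.
- apply: der_trans (cong_par IHx IHy) _.
  apply: psum_wprod; rewrite ?mass_dist ?nonneg_dist //.
  + exact: cong_par.
  + exact: ax_par_pchl.
  + exact: ax_par_pchr.
- apply: der_trans (cong_lmerge IHx IHy) _.
  apply: psum_wprod; rewrite ?mass_dist ?nonneg_dist //.
  + exact: cong_lmerge.
  + exact: ax_lmerge_pchl.
  + exact: ax_lmerge_pchr.
- apply: der_trans (cong_cmerge IHx IHy) _.
  apply: psum_wprod; rewrite ?mass_dist ?nonneg_dist //.
  + exact: cong_cmerge.
  + exact: ax_cmerge_pchl.
  + exact: ax_cmerge_pchr.
- apply: der_trans (cong_encap H IHx) _.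
  apply: psum_map; rewrite ?mass_dist ?nonneg_dist ?ltr01 //.
  + by move=> u v; exact: cong_encap.
  + by move=> *; exact: ax_encap_pch.
Qed.

(* Splitting off the class of the head of [l] on both sides reduces the lists
   to one summand with equal weights followed by smaller lists. *)
Lemma psum_classes (B : rel term) l l' : reflexive B -> symmetric B -> transitive B ->
  nonneg l -> nonneg l' -> 0 < mass l -> mass l = mass l' ->
  {in unzip2 l, forall z, weight (B z) l = weight (B z) l'} ->
  {in unzip2 l, forall z, {in unzip2 l ++ unzip2 l', forall u, B z u -> z ≡ u}} ->
  psum l ≡ psum l'.
Proof.
move=> Brefl Bsym Btrans.
have [n] := ubnP (size l); elim: n l l' => // n IH l l' ln nl nl' t0 tt' wl Bl.
have [z zl [k kn]] : exists2 z, z \in unzip2 l &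
    exists2 k, (k < size l)%N & size [seq i <- l | ~~ B z i.2] = k.
  case: l ln nl t0 {tt' wl Bl} => [|[w z] m] /=; first by rewrite mass_nil ltxx.
  move=> ln _ _; exists z; first by rewrite mem_head.
  eexists; last by []; rewrite Brefl /= size_filter ltnS; exact: count_size.
move=> sk.
have wz := wl _ zl.
have wz' : weight (predC (B z)) l = weight (predC (B z)) l'.
  by move: tt'; rewrite (mass_split (B z) l) (mass_split (B z) l') wz => /addrI.
have w0 Q : 0 <= weight Q l by rewrite -mass_filter mass_ge0 ?nonneg_filter.
rewrite (psum_split (B z) nl) (psum_split (B z) nl') -wz -wz'.
apply: wch_cong => //; first by rewrite -mass_split.
- move=> wp; transitivity z.
    apply: psum_const; rewrite ?nonneg_filter ?mass_filter // => u /mem_wfilter[Bu ul].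
    by symmetry; apply: Bl => //; rewrite mem_cat ul.
  symmetry; apply: psum_const; rewrite ?nonneg_filter ?mass_filter -?wz // => u /mem_wfilter[Bu ul].
  by symmetry; apply: Bl => //; rewrite mem_cat ul orbT.
- move=> wp; apply: IH.
  + by rewrite sk (leq_trans kn).
  + exact: (nonneg_filter (predC (B z))).
  + exact: (nonneg_filter (predC (B z))).
  + by rewrite (mass_filter (predC (B z))).
  + by rewrite !(mass_filter (predC (B z))).
  + move=> y /(@mem_wfilter _ _ (predC (B z))) [/= zy yl].
    have E m : weight (B y) [seq i <- m | ~~ B z i.2] = weight (B y) m.
      rewrite (@weight_filter _ _ _ (predC (B z))); apply: eq_bigl => i /=.
      case yi: (B y i.2); rewrite ?andbF // andbT.
      by apply: contra zy => zi; apply: Btrans zi _; rewrite Bsym.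
    by rewrite !E wl.
  + move=> y /(@mem_wfilter _ _ (predC (B z))) [/= zy yl] u; rewrite mem_cat => um; apply: Bl => //.
    by rewrite mem_cat; case/orP: um => /(@mem_wfilter _ _ (predC (B z))) [_ ->]; rewrite ?orbT.
Qed.

End ConvexCombinations.

(** * Head normal forms of resolved terms *)

Inductive summand (A : Type) (R : realFieldType) : Type :=
  Summand of option A & option (term A R).

HB.instance Definition _ (A : Type) (R : realFieldType) :=
  gen_eqMixin (summand A R).
HB.instance Definition _ (A : Type) (R : realFieldType) :=
  gen_choiceMixin (summand A R).

Section HeadNormalForms.
Variables (A : Type) (gamma : option A -> option A -> option A).
Hypothesis gammaC : commutative gamma.
Hypothesis gamma_delta : forall a, gamma None a = None.
Variable R : realFieldType.
Notation term := (term A R).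
Notation summand := (summand A R).
Notation "x ≡ y" := (@derivable A gamma R x y) (at level 70, no associativity).
Implicit Types (x y z : term) (s : summand).

#[local] Instance alt_proper :
  Proper (@derivable A gamma R ==> @derivable A gamma R ==> @derivable A gamma R)
    (@Alt A R).
Proof. by move=> x x' xx' y y' yy'; exact: cong_alt. Qed.

#[local] Instance seq_proper :
  Proper (@derivable A gamma R ==> @derivable A gamma R ==> @derivable A gamma R)
    (@Seq A R).
Proof. by move=> x x' xx' y y' yy'; exact: cong_seq. Qed.

Definition term_of s : term :=
  let: Summand a o := s in if o is Some u then Seq (Cst a) u else Cst a.

Definition seq_summand y s :=
  let: Summand a o := s in Summand a (Some (if o is Some u then Seq u y else y)).
Definition lmerge_summand y s :=
  let: Summand a o := s in Summand a (Some (if o is Some u then Par u y else y)).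
Definition rmerge_summand x s :=
  let: Summand a o := s in Summand a (Some (if o is Some u then Par x u else x)).
Definition cmerge_summand s s' :=
  let: Summand a o := s in let: Summand b o' := s' in
  Summand (gamma a b)
    (match o, o' with
     | Some u, Some v => Some (Par u v)
     | Some u, None => Some u
     | None, o' => o'
     end).
Definition encap_summand (H : set A) s :=
  let: Summand a o := s in
  Summand (if `[< (Some @` H)%classic a >] then None else a) (omap (Encap H) o).

Fixpoint summands (t : term) : seq summand :=
  match t with
  | Cst a => [:: Summand a None]
  | Alt x y => summands x ++ summands y
  | Seq x y => [seq seq_summand y s | s <- summands x]
  | Pch _ _ _ => [::]
  | Par x y =>
      ([seq lmerge_summand y s | s <- summands x] ++
       [seq rmerge_summand x s | s <- summands y]) ++
      [seq cmerge_summand s s' | s <- summands x, s' <- summands y]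
  | Lmerge x y => [seq lmerge_summand y s | s <- summands x]
  | Cmerge x y => [seq cmerge_summand s s' | s <- summands x, s' <- summands y]
  | Encap H x => [seq encap_summand H s | s <- summands x]
  end.

Definition step z a (o : option term) : Prop :=
  if o is Some u then trans gamma z a u else terminates gamma z a.

Lemma gamma_someP a b c : gamma a b = Some c ->
  exists a' b', a = Some a' /\ b = Some b'.
Proof.
case: a b => [a|] [b|]; rewrite ?gamma_delta //; first by exists a, b.
by rewrite gammaC gamma_delta.
Qed.

Lemma summands_step z a o :
  resolved z -> Summand (Some a) o \in summands z -> step z a o.
Proof.
elim: z a o => [c|x IHx y IHy|x IHx y _|r x IHx y IHy|x IHx y IHy|x IHx y IHy
  |x IHx y IHy|H x IHx] a o //=.
- by move=> _; rewrite inE => /eqP[<- ->]; exact: tm_cst.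
- move=> /andP[rx ry]; rewrite mem_cat => /orP[/(IHx _ _ rx)|/(IHy _ _ ry)].
    by case: o => [u|] /= h; [apply: tr_altl h (ptrans_resolved ry)
      | apply: tm_altl h (ptrans_resolved ry)].
  by case: o => [u|] /= h; [apply: tr_altr (ptrans_resolved rx) h
      | apply: tm_altr (ptrans_resolved rx) h].
- move=> rx /mapP[[b [u|]]] sx [? ->]; subst b => /=.
    exact: tr_seq (IHx _ _ rx sx).
  exact: tr_seq_term (IHx _ _ rx sx).
- move=> /andP[rx ry]; rewrite !mem_cat -orbA => /or3P[].
  + move=> /mapP[[b [u|]]] sx [? ->]; subst b => /=.
      exact: tr_parl (IHx _ _ rx sx) (ptrans_resolved ry).
    exact: tr_parl_term (IHx _ _ rx sx) (ptrans_resolved ry).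
  + move=> /mapP[[b [u|]]] sy [? ->]; subst b => /=.
      exact: tr_parr (ptrans_resolved rx) (IHy _ _ ry sy).
    exact: tr_parr_term (ptrans_resolved rx) (IHy _ _ ry sy).
  + move=> /allpairsP[[[b o1] [c o2]] /= [sx sy [gE ->]]].
    have [b' [c' [? ?]]] := gamma_someP (esym gE); subst b c.
    case: o1 o2 sx sy => [u|] [v|] /(IHx _ _ rx) sx /(IHy _ _ ry) sy /=.
    * exact: tr_par sx sy _.
    * exact: tr_par_termr sx sy _.
    * exact: tr_par_terml sx sy _.
    * exact: tm_par sx sy _.
- move=> /andP[rx ry] /mapP[[b [u|]]] sx [? ->]; subst b => /=.
    exact: tr_lmerge (IHx _ _ rx sx) (ptrans_resolved ry).
  exact: tr_lmerge_term (IHx _ _ rx sx) (ptrans_resolved ry).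
- move=> /andP[rx ry] /allpairsP[[[b o1] [c o2]] /= [sx sy [gE ->]]].
  have [b' [c' [? ?]]] := gamma_someP (esym gE); subst b c.
  case: o1 o2 sx sy => [u|] [v|] /(IHx _ _ rx) sx /(IHy _ _ ry) sy /=.
  + exact: tr_cmerge sx sy _.
  + exact: tr_cmerge_termr sx sy _.
  + exact: tr_cmerge_terml sx sy _.
  + exact: tm_cmerge sx sy _.
- move=> rx /mapP[[b o1]] sx [+ ->]; case: asboolP => // bH ?; subst b.
  have aH : ~ H a by move=> Ha; apply: bH; exists a.
  case: o1 sx => [u|] /(IHx _ _ rx) sx /=; [exact: tr_encap|exact: tm_encap].
Qed.

Lemma encap_summandN (H : set A) a o : ~ H a ->
  encap_summand H (Summand (Some a) o) = Summand (Some a) (omap (Encap H) o).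
Proof. by move=> Ha /=; case: asboolP => // -[b Hb [ba]]; case: Ha; rewrite -ba. Qed.

Lemma terminates_summands z a :
  terminates gamma z a -> resolved z -> Summand (Some a) None \in summands z.
Proof.
elim=> {z a} //=.
- by move=> a _; rewrite mem_head.
- by move=> x y y' a _ IH _ /andP[rx ry]; rewrite mem_cat IH.
- by move=> x x' y a _ _ IH /andP[rx ry]; rewrite mem_cat IH ?orbT.
- move=> x y a b c _ IHx _ IHy gE /andP[rx ry]; rewrite mem_cat; apply/orP; right.
  by apply/allpairsP; exists (Summand (Some a) None, Summand (Some b) None);
    rewrite /= gE; split; [exact: IHx|exact: IHy|].
- move=> x y a b c _ IHx _ IHy gE /andP[rx ry].
  by apply/allpairsP; exists (Summand (Some a) None, Summand (Some b) None);
    rewrite /= gE; split; [exact: IHx|exact: IHy|].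
- move=> H x a _ IH Ha rx; apply/mapP; exists (Summand (Some a) None); first exact: IH.
  by rewrite encap_summandN.
Qed.

Lemma trans_summands z a u :
  trans gamma z a u -> resolved z -> Summand (Some a) (Some u) \in summands z.
Proof.
have T := terminates_summands.
elim=> {z a u} //=.
- by move=> x y x' y' a _ IH _ /andP[rx ry]; rewrite mem_cat IH.
- by move=> x y x' y' a _ _ IH /andP[rx ry]; rewrite mem_cat IH ?orbT.
- by move=> x y a /T sx /sx {}sx; apply/mapP; exists (Summand (Some a) None).
- by move=> x y x' a _ IH /IH sx; apply/mapP; exists (Summand (Some a) (Some x')).
- move=> x y y' a /T sx _ /andP[/sx {}sx ry]; rewrite !mem_cat.
  by apply/orP; left; apply/orP; left; apply/mapP; exists (Summand (Some a) None).
- move=> x x' y a _ /T sy /andP[rx /sy {}sy]; rewrite !mem_cat.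
  by apply/orP; left; apply/orP; right; apply/mapP; exists (Summand (Some a) None).
- move=> x y x' y' a _ IH _ /andP[/IH sx ry]; rewrite !mem_cat.
  by apply/orP; left; apply/orP; left; apply/mapP; exists (Summand (Some a) (Some x')).
- move=> x y x' y' a _ _ IH /andP[rx /IH sy]; rewrite !mem_cat.
  by apply/orP; left; apply/orP; right; apply/mapP; exists (Summand (Some a) (Some y')).
- move=> x y y' a b c /T sx _ IH gE /andP[/sx {}sx /IH sy]; rewrite !mem_cat.
  apply/orP; right; apply/allpairsP.
  by exists (Summand (Some a) None, Summand (Some b) (Some y')); rewrite /= gE.
- move=> x y x' a b c _ IH /T sy gE /andP[/IH sx /sy {}sy]; rewrite !mem_cat.
  apply/orP; right; apply/allpairsP.
  by exists (Summand (Some a) (Some x'), Summand (Some b) None); rewrite /= gE.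
- move=> x y x' y' a b c _ IHx _ IHy gE /andP[/IHx sx /IHy sy]; rewrite !mem_cat.
  apply/orP; right; apply/allpairsP.
  by exists (Summand (Some a) (Some x'), Summand (Some b) (Some y')); rewrite /= gE.
- move=> x y y' a /T sx _ /andP[/sx {}sx ry].
  by apply/mapP; exists (Summand (Some a) None).
- move=> x y x' y' a _ IH _ /andP[/IH sx ry].
  by apply/mapP; exists (Summand (Some a) (Some x')).
- move=> x y y' a b c /T sx _ IH gE /andP[/sx {}sx /IH sy]; apply/allpairsP.
  by exists (Summand (Some a) None, Summand (Some b) (Some y')); rewrite /= gE.
- move=> x y x' a b c _ IH /T sy gE /andP[/IH sx /sy {}sy]; apply/allpairsP.
  by exists (Summand (Some a) (Some x'), Summand (Some b) None); rewrite /= gE.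
- move=> x y x' y' a b c _ IHx _ IHy gE /andP[/IHx sx /IHy sy]; apply/allpairsP.
  by exists (Summand (Some a) (Some x'), Summand (Some b) (Some y')); rewrite /= gE.
- move=> H x x' a _ IH Ha rx; apply/mapP.
  by exists (Summand (Some a) (Some x')); rewrite ?encap_summandN //; exact: IH.
Qed.

Lemma leaves_summand z a u :
  Summand a (Some u) \in summands z -> (leaves u < leaves z)%N.
Proof.
elim: z a u => [c|x IHx y IHy|x IHx y _|r x IHx y IHy|x IHx y IHy|x IHx y IHy
  |x IHx y IHy|H x IHx] a u //=; rewrite ?mem_cat.
- by rewrite inE => /eqP.
- case/orP => [/IHx|/IHy] lu; first exact: leq_trans lu (leq_addr _ _).
  exact: leq_trans lu (leq_addl _ _).
- move=> /mapP[[b [v|]] sx [_ ->]] /=; first by rewrite ltn_add2r (IHx _ _ sx).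
  by rewrite -{1}[leaves y]add0n ltn_add2r leaves_gt0.
- rewrite -orbA => /or3P[].
  + move=> /mapP[[b [v|]] sx [_ ->]] /=; first by rewrite ltn_add2r (IHx _ _ sx).
    by rewrite -{1}[leaves y]add0n ltn_add2r leaves_gt0.
  + move=> /mapP[[b [v|]] sy [_ ->]] /=; first by rewrite ltn_add2l (IHy _ _ sy).
    by rewrite -{1}[leaves x]addn0 ltn_add2l leaves_gt0.
  + move=> /allpairsP[[[b [v|]] [c [w|]]] /= [sx sy [_ //]]] ->.
    * by rewrite -addSn leq_add ?(IHx _ _ sx) // ltnW // (IHy _ _ sy).
    * by rewrite (leq_trans (IHx _ _ sx)) ?leq_addr.
    * by rewrite (leq_trans (IHy _ _ sy)) ?leq_addl.
- move=> /mapP[[b [v|]] sx [_ ->]] /=; first by rewrite ltn_add2r (IHx _ _ sx).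
  by rewrite -{1}[leaves y]add0n ltn_add2r leaves_gt0.
- move=> /allpairsP[[[b [v|]] [c [w|]]] /= [sx sy [_ //]]] ->.
  + by rewrite -addSn leq_add ?(IHx _ _ sx) // ltnW // (IHy _ _ sy).
  + by rewrite (leq_trans (IHx _ _ sx)) ?leq_addr.
  + by rewrite (leq_trans (IHy _ _ sy)) ?leq_addl.
- by move=> /mapP[[b [v|]] sx [_ //]] -> /=; rewrite (IHx _ _ sx).
Qed.

Definition tsum (l : seq term) : term := foldr Alt (Cst None) l.

Lemma delta_alt x : Cst None + x ≡ x.
Proof. by rewrite ax_altC ax_alt_delta; reflexivity. Qed.

Lemma tsum_cat l l' : tsum (l ++ l') ≡ tsum l + tsum l'.
Proof.
elim: l => /= [|x l IH]; first by rewrite delta_alt; reflexivity.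
by rewrite IH ax_altA; reflexivity.
Qed.

Lemma tsum_cong (T : eqType) (f g : T -> term) (l : seq T) :
  {in l, forall i, f i ≡ g i} -> tsum [seq f i | i <- l] ≡ tsum [seq g i | i <- l].
Proof.
elim: l => /= [_|i l IH fg]; first exact: der_refl.
apply: cong_alt; first by apply: fg; rewrite mem_head.
by apply: IH => j jl; apply: fg; rewrite inE jl orbT.
Qed.

Lemma tsum_map (f : term -> term) l :
  (forall x y, f (Alt x y) ≡ f x + f y) -> f (Cst None) ≡ Cst None ->
  f (tsum l) ≡ tsum (map f l).
Proof. by move=> fA f0; elim: l => //= x l IH; rewrite fA IH; reflexivity. Qed.

Lemma term_of_idem s : term_of s + term_of s ≡ term_of s.
Proof.
case: s => a [u|] /=; last exact: ax_altI.
by rewrite -ax_alt_seq ax_altI; reflexivity.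
Qed.

Lemma altACA x y z w : (x + y) + (z + w) ≡ (x + z) + (y + w).
Proof.
rewrite !ax_altA; apply: cong_alt; first exact: der_refl.
by rewrite -!ax_altA; apply: cong_alt; [exact: ax_altC|exact: der_refl].
Qed.

Lemma tsum_idem l : {in l, forall x, x + x ≡ x} -> tsum l + tsum l ≡ tsum l.
Proof.
elim: l => /= [_|x l IH lI]; first exact: ax_altI.
rewrite altACA; apply: cong_alt; first by apply: lI; rewrite mem_head.
by apply: IH => y yl; apply: lI; rewrite inE yl orbT.
Qed.

Lemma tsum_absorb l x : x \in l -> x + x ≡ x -> tsum l + x ≡ tsum l.
Proof.
move=> xl xx; elim: l xl => //= y l IH; rewrite inE => /predU1P[<-|/IH {}IH].
  by rewrite ax_altC -ax_altA xx; reflexivity.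
by rewrite ax_altA IH; reflexivity.
Qed.

Definition hnf z : term := tsum (map term_of (summands z)).

Lemma alt_idem_hnf z : z ≡ hnf z -> z ≡ z + z.
Proof.
move=> zE; apply: der_trans _ (cong_alt (der_sym zE) (der_sym zE)).
apply: der_trans zE _; symmetry; apply: tsum_idem => _ /mapP[s _ ->].
exact: term_of_idem.
Qed.

Lemma lmerge_hnf x y : x ≡ hnf x ->
  x ⌊⌊ y ≡ tsum [seq term_of (lmerge_summand y s) | s <- summands x].
Proof.
move=> xE; transitivity (hnf x ⌊⌊ y)%pacp.
  by apply: cong_lmerge => //; exact: der_refl.
rewrite (@tsum_map (Lmerge^~ y)).
- rewrite -map_comp; apply: tsum_cong => -[a [u|]] _ /=.
    exact: ax_lmerge_pre.
  exact: ax_lmerge_cst.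
- by move=> *; exact: ax_lmerge_alt.
- by rewrite ax_lmerge_cst ax_delta_seq; reflexivity.
Qed.

Lemma cmerge_term_of s s' : term_of s ∣ term_of s' ≡ term_of (cmerge_summand s s').
Proof.
case: s s' => a [u|] [b [v|]] /=.
- exact: ax_cmerge_pre.
- exact: ax_cmerge_pre_cst.
- exact: ax_cmerge_cst_pre.
- exact: ax_cmerge_cst.
Qed.

Lemma cmerge_hnf x y : x ≡ hnf x -> y ≡ hnf y -> x ∣ y ≡
  tsum (map term_of [seq cmerge_summand s s' | s <- summands x, s' <- summands y]).
Proof.
move=> xE yE; apply: der_trans (cong_cmerge xE yE) _.
rewrite (@tsum_map (Cmerge^~ (hnf y))); last 2 first.
- by move=> *; exact: ax_cmerge_altl.
- exact: ax_cmerge_deltal.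
elim: (summands x) => /= [|s l IH]; first exact: der_refl.
rewrite map_cat tsum_cat -IH; apply: cong_alt; last exact: der_refl.
rewrite (@tsum_map (Cmerge (term_of s))); last 2 first.
- by move=> *; exact: ax_cmerge_altr.
- exact: ax_cmerge_deltar.
rewrite -!map_comp; apply: tsum_cong => s' _ /=; exact: cmerge_term_of.
Qed.

Lemma cmerge_tsumC l l' : {in l & l', forall u v, u ∣ v ≡ v ∣ u} ->
  tsum l ∣ tsum l' ≡ tsum l' ∣ tsum l.
Proof.
elim: l => /= [_|u l IHl uvC]; first
  by rewrite ax_cmerge_deltal ax_cmerge_deltar; reflexivity.
rewrite ax_cmerge_altl ax_cmerge_altr; apply: cong_alt; last first.
  by apply: IHl => v w vl; apply: uvC; rewrite inE vl orbT.
elim: l' uvC {IHl} => /= [_|v l' IHl' uvC].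
  by rewrite ax_cmerge_deltal ax_cmerge_deltar; reflexivity.
rewrite ax_cmerge_altl ax_cmerge_altr; apply: cong_alt.
  by apply: uvC; rewrite mem_head.
by apply: IHl' => w1 w2 w1l w2l; apply: uvC => //; rewrite inE w2l orbT.
Qed.

(* The axioms expand [x ∥ y] with residuals [y' ∥ x], the transitions have
   [x ∥ y'] instead; commutativity of [∥] bridges the gap, and is in turn proved
   from head normal forms of terms with fewer leaves. *)
Lemma resolved_hnf_of_parC n :
  (forall x y, (leaves x + leaves y < n)%N -> x ∥ y ≡ y ∥ x) ->
  forall z, resolved z -> (leaves z <= n)%N -> z ≡ hnf z.
Proof.
move=> parC; elim=> [a|x IHx y IHy|x IHx y _|r x IHx y IHy|x IHx y IHy
  |x IHx y IHy|x IHx y IHy|H x IHx] //=.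
all: try (move=> /andP[rx ry] xyn;
  have xE := IHx rx (leq_trans (leq_addr _ _) xyn);
  have yE := IHy ry (leq_trans (leq_addl _ _) xyn)).
- by move=> _ _; rewrite /hnf /= ax_alt_delta; reflexivity.
- by rewrite /hnf /= map_cat tsum_cat; exact: cong_alt.
- move=> rx xyn; have xE := IHx rx (leq_trans (leq_addr _ _) xyn).
  rewrite {1}xE (@tsum_map (Seq^~ y)).
  + rewrite /hnf /= -!map_comp; apply: tsum_cong => -[a [u|]] _ /=.
      exact: ax_seqA.
    exact: der_refl.
  + by move=> *; exact: ax_alt_seq.
  + exact: ax_delta_seq.
- apply: der_trans (ax_par (alt_idem_hnf xE) (alt_idem_hnf yE)) _.
  rewrite /hnf /= !map_cat !tsum_cat -!map_comp.
  apply: cong_alt; last exact: cmerge_hnf.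
  apply: cong_alt; first exact: lmerge_hnf.
  rewrite (lmerge_hnf _ yE); apply: tsum_cong => -[a [v|]] sy /=; last exact: der_refl.
  apply: cong_seq; first exact: der_refl.
  apply: parC; rewrite addnC; apply: leq_trans xyn.
  by rewrite ltn_add2l (leaves_summand sy).
- by rewrite /hnf /= -map_comp; exact: lmerge_hnf.
- exact: cmerge_hnf.
- move=> rx xn; apply: der_trans (cong_encap H (IHx rx xn)) _.
  have E a : ∂ H ⟨a⟩ ≡ Cst (if `[< (Some @` H)%classic a >] then None else a).
    by case: asboolP => aH; [exact: ax_encap_in|exact: ax_encap_notin].
  rewrite (@tsum_map (Encap H)).
  + rewrite /hnf /= -!map_comp; apply: tsum_cong => -[a [u|]] _ /=.
      by rewrite ax_encap_seq E; reflexivity.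
    exact: E.
  + by move=> *; exact: ax_encap_alt.
  + by apply: ax_encap_notin => -[].
Qed.

Lemma parC x y : x ∥ y ≡ y ∥ x.
Proof.
have [n] := ubnP (leaves x + leaves y); elim: n x y => // n IH.
suff parC_resolved x y : resolved x -> resolved y ->
    (leaves x + leaves y < n.+1)%N -> x ∥ y ≡ y ∥ x.
  move=> x y xyn.
  have red (u : term) (P : pred term) :
      (forall z, P z -> u ∥ z ≡ z ∥ u) ->
      forall t, {in unzip2 (dist t), forall z, P z} -> u ∥ t ≡ t ∥ u.
    move=> uP t tP; have tE := psum_dist gamma t.
    have u_refl := der_refl gamma u.
    apply: der_trans (cong_par u_refl tE) _.
    apply: der_trans _ (cong_par (der_sym tE) u_refl).
    rewrite (@psum_map _ gamma _ (Par u)) ?nonneg_dist ?mass_dist ?ltr01 //.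
    + rewrite (@psum_map _ gamma _ (Par^~ u)) ?nonneg_dist ?mass_dist ?ltr01 //.
      * by apply: psum_cong => [|z /tP/uP]; rewrite ?nonneg_dist.
      * by move=> v w vw; exact: cong_par.
      * by move=> *; exact: ax_par_pchl.
    + by move=> v w vw; exact: cong_par.
    + by move=> *; exact: ax_par_pchr.
  apply: (red x (fun v => v \in unzip2 (dist y))) => // v /mem_distP[rv vy].
  symmetry; apply: (red v (fun u => u \in unzip2 (dist x))) => // u /mem_distP[ru ux].
  apply: parC_resolved => //; rewrite addnC; apply: leq_ltn_trans xyn.
  exact: leq_add.
rewrite ltnS => rx ry xyn.
have hE z : resolved z -> (leaves z <= n)%N -> z ≡ hnf z.
  by apply: resolved_hnf_of_parC => u v; exact: IH.
have xE := hE _ rx (leq_trans (leq_addr _ _) xyn).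
have yE := hE _ ry (leq_trans (leq_addl _ _) xyn).
have [xI yI] := (alt_idem_hnf xE, alt_idem_hnf yE).
apply: der_trans (ax_par xI yI) _; apply: der_trans _ (der_sym (ax_par yI xI)).
apply: cong_alt; first exact: ax_altC.
apply: der_trans (cong_cmerge xE yE) _.
apply: der_trans _ (cong_cmerge (der_sym yE) (der_sym xE)).
apply: cmerge_tsumC => _ _ /mapP[s sx ->] /mapP[s' sy ->].
rewrite !cmerge_term_of; case: s s' sx sy => a [u|] [b [v|]] sx sy /=;
  rewrite gammaC; try exact: der_refl.
apply: cong_seq; first exact: der_refl.
apply: IH; apply: leq_trans xyn.
by rewrite -addSn leq_add ?(leaves_summand sx) // ltnW ?(leaves_summand sy).
Qed.

Lemma resolved_hnf z : resolved z -> z ≡ hnf z.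
Proof.
by move=> rz; apply: (@resolved_hnf_of_parC (leaves z)) => // *; exact: parC.
Qed.

Lemma resolved_step_absorb z a o : resolved z -> step z a o ->
  z + term_of (Summand (Some a) o) ≡ z.
Proof.
move=> rz zao; rewrite (resolved_hnf rz).
apply: tsum_absorb; last exact: term_of_idem.
apply/map_f; case: o zao => [u|] zao; first exact: trans_summands.
exact: terminates_summands.
Qed.

Lemma resolved_absorb z z' : resolved z' ->
  (forall a o, step z' a o -> z + term_of (Summand (Some a) o) ≡ z) -> z + z' ≡ z.
Proof.
move=> rz' zz'; rewrite {1}(resolved_hnf rz') /hnf.
have: {in summands z', forall s, z + term_of s ≡ z}.
  move=> [[a|] o] sz; first exact/zz'/summands_step.
  by case: o sz => [u|] _ /=; rewrite ?ax_delta_seq; exact: ax_alt_delta.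
elim: (summands z') => /= [_|s l IH sP]; first exact: ax_alt_delta.
rewrite -ax_altA sP ?mem_head //; apply: IH => s' s'l.
by apply: sP; rewrite inE s'l orbT.
Qed.

Lemma bisimulation_derivable (B : term -> term -> Prop) t t' :
  prob_bisimulation gamma B -> B t t' -> t ≡ t'.
Proof.
move=> bB; have [n] := ubnP (maxn (leaves t) (leaves t')).
elim: n t t' => // n IH t t'; rewrite ltnS geq_max => /andP[tn t'n] Btt'.
have absorb z z' : resolved z -> resolved z' -> (leaves z <= n)%N ->
    (leaves z' <= n)%N -> B z z' -> z + z' ≡ z.
  move=> rz rz' zn z'n Bzz'; apply: resolved_absorb => // a [u'|] st.
    have [u zu Bu] := pb_act bB (pb_sym bB Bzz') st.
    rewrite /= (IH u' u) //; last first.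
      rewrite gtn_max (leq_trans (leaves_summand (trans_summands st rz')) z'n).
      exact: leq_trans (leaves_summand (trans_summands zu rz)) zn.
    exact: (@resolved_step_absorb z a (Some u)).
  exact: (@resolved_step_absorb z a None) (pb_term bB (pb_sym bB Bzz') st).
have resolved_eq z z' : resolved z -> resolved z' -> (leaves z <= n)%N ->
    (leaves z' <= n)%N -> B z z' -> z ≡ z'.
  move=> rz rz' zn z'n Bzz'; rewrite -(absorb z z') // ax_altC.
  by apply: absorb => //; exact: pb_sym bB _ _ Bzz'.
rewrite (psum_dist gamma t) (psum_dist gamma t').
apply: (@psum_classes _ gamma _ (fun u v => `[< B u v >]));
  rewrite ?nonneg_dist ?mass_dist ?ltr01 //.
- by move=> u; apply/asboolP; exact: pb_refl bB u.
- by move=> u v; apply/asboolP/asboolP; exact: pb_sym bB _ _.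
- by move=> u v w /asboolP vu /asboolP uw; apply/asboolP; exact: pb_trans bB _ _ _ vu uw.
- by move=> z _; have := pb_prob bB z Btt'; rewrite !PsetE.
- have dn z : z \in unzip2 (dist t) ++ unzip2 (dist t') -> resolved z /\ (leaves z <= n)%N.
    rewrite mem_cat => /orP[] /mem_distP[rz zn]; split => //.
      exact: leq_trans zn tn.
    exact: leq_trans zn t'n.
  move=> z zt u /dn[ru un] /asboolP.
  have [rz zn] : resolved z /\ (leaves z <= n)%N by apply: dn; rewrite mem_cat zt.
  exact: resolved_eq.
Qed.

End HeadNormalForms.

Theorem theorem2 (A : Type) (gamma : option A -> option A -> option A)
    (gammaC : commutative gamma) (gammaA : associative gamma)
    (gamma_delta : forall a, gamma None a = None)
    (R : realFieldType) (t t' : term A R) :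
  bisimilar gamma t t' -> derivable gamma t t'.
Proof. by case=> B bB Btt'; exact: bisimulation_derivable bB Btt'. Qed.
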